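(* Let $X$ be a real vector space and suppose that, for each $n\in\mathbb{N}$ and each $\bm{x}=(x_1,\ldots,x_n)\in X^n$, there is a linear map $\Psi_{\bm{x}}\colon PG_n^h\to X$ such that this family of maps satisfies $$\Psi_{\bm{x}}(\pi_i)=x_i\quad\text{for } i=1,\ldots,n$$ for each $n\in\mathbb{N}$ and $\bm{x}\in X^n$, and $$\Psi_{(\Psi_{\bm{x}}(f_1),\ldots,\Psi_{\bm{x}}(f_m))}(g)=\Psi_{\bm{x}}(g\circ(f_1\times\cdots\times f_m))$$ for each $m,n\in\mathbb{N}$, $\bm{x}\in X^n$, $f_1,\ldots,f_m\in PG_n^h$ and $g\in PG_m^h$, where $f_1\times\cdots\times f_m\colon\mathbb{R}^n\to\mathbb{R}^m$ is defined by $(f_1\times\cdots\times f_m)(t)=(f_1(t),\ldots,f_m(t))$. Then $X$ can be endowed with the structure of a commutative $f$-algebra that admits a polynomial growth continuous function calculus without constants.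
   Context: Here $\mathbb{N}=\{1,2,\ldots\}$. A lattice-ordered algebra is a real vector lattice that is also an associative real algebra in which the product of positive elements is positive. An $f$-algebra is a lattice-ordered algebra in which $x\wedge y=0$ and $z\ge 0$ imply $(zx)\wedge y=(xz)\wedge y=0$. A lattice-algebra homomorphism is a linear map preserving lattice operations and products. Endowing the vector space $X$ with the structure of an $f$-algebra means giving an order and a product on $X$ that make it an $f$-algebra with the given linear structure. $PG_n$ denotes the lattice-ordered algebra (with pointwise operations) of continuous functions $f\colon\mathbb{R}^n\to\mathbb{R}$ of polynomial growth, i.e. for which there exist $N\in\mathbb{N}$ and $M\in[0,\infty)$ with $|f|\le M(\mathbf{1}+|\pi_1|+\cdots+|\pi_n|)^N$. Here $\mathbf{1}$ is the constant function one on $\mathbb{R}^n$ and $\pi_i\colon\mathbb{R}^n\to\mathbb{R}$ is the $i$-th coordinate projection. $PG_n^h$ is the set of $f\in PG_n$ for which the limit $\lim_{t\to0^+}f(tx)/t$ exists for every $x\in\mathbb{R}^n$ and is uniform on bounded subsets of $\mathbb{R}^n$; it is a lattice-ordered algebra with the pointwise operations. If $f_1,\ldots,f_m\in PG_n^h$ and $g\in PG_m^h$, then $g\circ(f_1\times\cdots\times f_m)\in PG_n^h$. A lattice-ordered algebra $X$ admits a polynomial growth continuous function calculus without constants if, for each $n\in\mathbb{N}$ and each $\bm{x}=(x_1,\ldots,x_n)\in X^n$, there is a lattice-algebra homomorphism $\Psi_{\bm{x}}^h\colon PG_n^h\to X$ satisfying $\Psi_{\bm{x}}^h(\pi_i)=x_i$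 for $i=1,\ldots,n$. *)

(* Defs.v *)
From HB Require Import structures.
From mathcomp Require Import all_boot all_order all_algebra.
From mathcomp Require Import ring.
From mathcomp Require Import all_classical all_reals all_analysis.

Set Implicit Arguments.
Unset Strict Implicit.
Unset Printing Implicit Defensive.

Import Order.TTheory GRing.Theory Num.Theory.
Import numFieldNormedType.Exports.

Local Open Scope classical_set_scope.
Local Open Scope ring_scope.

(* The product is not assumed to have a unit, so MathComp's algebra structures
   do not apply.  The order of a vector lattice determines [la_join] and
   [la_meet]. *)
Record lattice_algebra (R : realType) (V : lmodType R) := LatticeAlgebra {
  la_le : rel V;
  la_join : V -> V -> V;
  la_meet : V -> V -> V;
  la_mul : V -> V -> V;
  la_le_refl : reflexive la_le;
  la_le_anti : antisymmetric la_le;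
  la_le_trans : transitive la_le;
  la_leD : forall x y z, la_le x y -> la_le (x + z) (y + z);
  la_leZ : forall (a : R) x y, 0 <= a -> la_le x y -> la_le (a *: x) (a *: y);
  la_joinP : forall x y z, la_le (la_join x y) z = la_le x z && la_le y z;
  la_meetP : forall x y z, la_le z (la_meet x y) = la_le z x && la_le z y;
  la_mulA : associative la_mul;
  la_mulDl : left_distributive la_mul +%R;
  la_mulDr : right_distributive la_mul +%R;
  la_mulZl : forall (a : R) x y, la_mul (a *: x) y = a *: la_mul x y;
  la_mulZr : forall (a : R) x y, la_mul x (a *: y) = a *: la_mul x y;
  la_mul_ge0 : forall x y, la_le 0 x -> la_le 0 y -> la_le 0 (la_mul x y)
}.

Definition f_algebra (R : realType) (V : lmodType R) (A : lattice_algebra V) :=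
  forall x y z : V, la_meet A x y = 0 -> la_le A 0 z ->
    la_meet A (la_mul A z x) y = 0 /\ la_meet A (la_mul A x z) y = 0.

Definition lattice_algebra_hom (R : realType) (V W : lmodType R)
    (A : lattice_algebra V) (B : lattice_algebra W) (h : {linear V -> W}) :=
  [/\ {morph h : x y / la_join A x y >-> la_join B x y},
      {morph h : x y / la_meet A x y >-> la_meet B x y} &
      {morph h : x y / la_mul A x y >-> la_mul B x y}].

Section PolynomialGrowth.
Variable R : realType.

Definition polynomial_growth n (f : 'rV[R]_n -> R) :=
  exists N : nat, exists M : R, [/\ (0 < N)%N, 0 <= M &
    forall x, `|f x| <= M * (1 + \sum_(i < n) `|x ord0 i|) ^+ N].

Definition PG n : set ('rV[R]_n -> R) :=
  [set f | continuous f /\ polynomial_growth f].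

Definition ray_quotient n (f : 'rV[R]_n -> R) (t : R) (x : 'rV[R]_n) : R :=
  f (t *: x) / t.

(* $PG_n^h$. *)
Definition PGh_set n : set ('rV[R]_n -> R) :=
  [set f | PG f /\ exists fh : 'rV[R]_n -> R,
    (forall x, ray_quotient f t x @[t --> 0^'+] --> fh x) /\
    (forall B : set 'rV[R]_n, bounded_set B ->
      {uniform B, ray_quotient f t @[t --> 0^'+] --> fh})].

(* $f_1 \times \cdots \times f_m$. *)
Definition fun_prod n m (f : 'I_m -> 'rV[R]_n -> R) (x : 'rV[R]_n) : 'rV[R]_m :=
  \row_i f i x.

Lemma rV_norm_le n (x : 'rV[R]_n) (r : R) :
  0 <= r -> (forall i, `|x ord0 i| <= r) -> `|x| <= r.
Proof.
move=> r0 H; rewrite /Num.norm /= mx_normrE.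
by apply/bigmax_leP; split => // -[i j] _ /=; rewrite (ord1 i).
Qed.

Lemma rV_coord_le n (x : 'rV[R]_n) i : `|x ord0 i| <= `|x|.
Proof.
rewrite [leRHS]/Num.norm /= mx_normrE.
exact: (le_bigmax _ (fun ij => `|x ij.1 ij.2|) (ord0, i)).
Qed.

Lemma rV_norm_lt n (x : 'rV[R]_n) (r : R) :
  0 < r -> (forall i, `|x ord0 i| < r) -> `|x| < r.
Proof.
move=> r0 H; rewrite /Num.norm /= mx_normrE.
by apply/bigmax_ltP; split => // -[i j] _ /=; rewrite (ord1 i).
Qed.

Lemma near_rV_dist n (x : 'rV[R]_n) (e : R) :
  0 < e -> \forall y \near x, `|x - y| < e.
Proof.
by move=> e0; apply/nbhs_ballP; exists e => //= y; rewrite -ball_normE.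
Qed.

Lemma near_continuous_dist n (f : 'rV[R]_n -> R) (x : 'rV[R]_n) (e : R) :
  {for x, continuous f} -> 0 < e -> \forall y \near x, `|f x - f y| < e.
Proof.
move=> cf e0; have := cf _ (nbhsx_ballx (f x) e e0).
by apply: (@filterS _ _ (nbhs_filter x)) => y /=; rewrite -ball_normE.
Qed.

Lemma rV_continuousD n (f g : 'rV[R]_n -> R) :
  continuous f -> continuous g -> continuous (fun x => f x + g x).
Proof.
move=> cf cg x.
by apply: (@cvgD _ _ _ _ (nbhs_filter x) f g); [exact: cf|exact: cg].
Qed.

Lemma rV_continuousM n (f g : 'rV[R]_n -> R) :
  continuous f -> continuous g -> continuous (fun x => f x * g x).
Proof.
move=> cf cg x.
by apply: (@cvgM _ _ _ (nbhs_filter x) f g); [exact: cf|exact: cg].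
Qed.

Lemma rV_continuous_max n (f g : 'rV[R]_n -> R) :
  continuous f -> continuous g -> continuous (fun x => Num.max (f x) (g x)).
Proof.
move=> cf cg x.
by apply: (@continuous_max R _ f g x); [exact: cf|exact: cg].
Qed.

Lemma fun_prod_continuous n m (f : 'I_m -> 'rV[R]_n -> R) :
  (forall i, continuous (f i)) -> continuous (fun_prod f).
Proof.
move=> cf x.
apply/(@cvgrPdist_lt _ _ _ (nbhs x) (nbhs_filter x)) => e e0.
have : \forall y \near x, forall i, `|f i x - f i y| < e.
  apply: (@filter_forall _ _ _ _ (nbhs_filter x)) => i.
  by apply: near_continuous_dist => //; exact: cf.
apply: (@filterS _ _ (nbhs_filter x)) => y H; apply: rV_norm_lt => // i.
by rewrite !mxE.
Qed.

Lemma bounded_set_normP n (B : set 'rV[R]_n) :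
  bounded_set B <-> exists r : R, forall x, B x -> `|x| <= r.
Proof.
split=> [bB|[r Br]].
  near +oo_R => r; exists r; near: r; exact: bB.
exists r; split; first exact: num_real.
by move=> M rM x Bx; apply: le_trans (Br x Bx) _; exact: ltW.
Unshelve. all: by end_near. Qed.

(* The uniform limit in epsilon form, on balls. *)
Lemma PGh_setP n (f : 'rV[R]_n -> R) :
  PGh_set f <-> PG f /\ exists fh : 'rV[R]_n -> R, forall r e : R, 0 < e ->
    \forall t \near 0^'+, forall x, `|x| <= r ->
      `|fh x - ray_quotient f t x| < e.
Proof.
split=> [[pf [fh [_ H]]]|[pf [fh H]]]; split=> //; exists fh.
  move=> r e e0.
  have bB : bounded_set [set x : 'rV[R]_n | `|x| <= r].
    by apply/bounded_set_normP; exists r => x.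
  apply: (H _ bB [set h : 'rV[R]_n -> R |
    forall x, `|x| <= r -> `|fh x - h x| < e]).
  apply/uniform_nbhs; exists [set xy | ball xy.1 e xy.2]; split.
    by rewrite -entourage_ballE; exists e.
  by move=> h Hh x xr; exact: Hh.
split=> [x|B /bounded_set_normP [r Br]].
  apply/cvgrPdist_lt => e e0.
  by apply: filterS (H `|x| e e0) => t; exact.
move=> P /uniform_nbhs [E [entE HE]].
have [e e0 eE] : exists2 e : R, 0 < e & [set xy | ball xy.1 e xy.2] `<=` E.
  by move: entE; rewrite -entourage_ballE => -[e /= e0 sE]; exists e.
apply: filterS (H r e e0) => t Ht /=; apply: HE => x Bx.
by apply: eE; apply: Ht; exact: Br.
Qed.

Lemma homogeneous_PGh n (f : 'rV[R]_n -> R) (c : R) : continuous f ->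
    (forall t x, 0 < t -> f (t *: x) = t * f x) ->
    (forall x, `|f x| <= c * (1 + \sum_(i < n) `|x ord0 i|)) ->
  PGh_set f.
Proof.
move=> cf hf bf; apply/PGh_setP; split.
  split=> //; exists 1%N, `|c|; split=> // x; rewrite expr1.
  apply: le_trans (bf x) _; apply: ler_wpM2r (ler_norm c).
  by apply: addr_ge0 => //; apply: sumr_ge0.
exists f => r e e0; near=> t => x _.
have t0 : 0 < t by [].
by rewrite /ray_quotient hf// mulrAC divff ?gt_eqF// mul1r subrr normr0.
Unshelve. all: by end_near. Qed.

Lemma PGh_coord n (i : 'I_n) : PGh_set (fun x : 'rV[R]_n => x ord0 i).
Proof.
apply: (@homogeneous_PGh _ _ 1).
- exact: coord_continuous.
- by move=> t x t0; rewrite mxE.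
- move=> x; rewrite mul1r (bigD1 i)//= addrCA lerDl.
  by apply: addr_ge0 => //; apply: sumr_ge0.
Qed.

Section Limit.
Variables (n : nat) (f fh : 'rV[R]_n -> R).
Hypothesis cf : continuous f.
Hypothesis Hf : forall r e : R, 0 < e ->
  \forall t \near 0^'+, forall x, `|x| <= r ->
    `|fh x - ray_quotient f t x| < e.

Lemma ray_limit_continuous : continuous fh.
Proof.
move=> x.
apply/(@cvgrPdist_lt _ _ _ (nbhs x) (nbhs_filter x)) => e e0.
have e3 : 0 < e / 3 by rewrite divr_gt0.
near (0 : R)^'+ => t.
have Ht : forall y, `|y| <= `|x| + 1 -> `|fh y - ray_quotient f t y| < e / 3.
  by near: t; exact: Hf.
have cq : {for x, continuous (ray_quotient f t)}.
  apply: (@rV_continuousM _ (fun y => f (t *: y)) (fun=> t^-1)).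
    move=> y; apply: (@continuous_comp 'rV[R]_n 'rV[R]_n R
      (fun y => t *: y) f y); [exact: scaler_continuous|exact: cf].
  exact: cst_continuous.
near=> y.
have yx : `|y| <= `|x| + 1.
  have : `|x - y| < 1 by near: y; exact: near_rV_dist.
  move=> /ltW xy; rewrite -[y](subrK x) (le_trans (ler_normD _ _))// addrC.
  by rewrite lerD2l distrC.
have h1 : `|fh x - ray_quotient f t x| < e / 3 by apply: Ht; rewrite lerDl.
have h2 := Ht y yx.
have h3 : `|ray_quotient f t x - ray_quotient f t y| < e / 3.
  by near: y; exact: near_continuous_dist.
have -> : fh x - fh y = (fh x - ray_quotient f t x) +
  (ray_quotient f t x - ray_quotient f t y) + (ray_quotient f t y - fh y).
  by ring.
apply: le_lt_trans (ler_normD _ _) _; rewrite [`|_ - fh y|]distrC.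
apply: le_lt_trans (lerD (ler_normD _ _) (lexx _)) _.
have -> : e = e / 3 + e / 3 + e / 3 by field.
by rewrite !ltrD.
Unshelve. all: by end_near. Qed.

End Limit.

Lemma compact_rV_ball n (r : R) : compact [set x : 'rV[R]_n | `|x| <= r].
Proof.
apply: bounded_closed_compact; first by apply/bounded_set_normP; exists r => x.
have -> : [set x : 'rV[R]_n | `|x| <= r] =
  Num.norm @^-1` [set y | y <= r] by [].
by apply: preimage_closed (@closed_le R r) => x _; exact: norm_continuous.
Qed.

Lemma uniformly_continuous_rV_ball n (g : 'rV[R]_n -> R) (r e : R) :
  continuous g -> 0 < e -> \forall d \near 0^'+, forall y, `|y| <= r ->
    forall z, `|y - z| < d -> `|g y - g z| < e.
Proof.
move=> cg e0.
have /compact_near_coveringP nc := @compact_rV_ball n r.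
apply: (nc _ _ (fun d y => forall z, `|y - z| < d -> `|g y - g z| < e)).
move=> x _.
have e2 : 0 < e / 2 by rewrite divr_gt0.
have /nbhs_ballP[d /= d0 dg] := near_continuous_dist (cg x) e2.
have d2 : 0 < d / 2 by rewrite divr_gt0.
near=> y d' => z yz.
have xy : `|x - y| < d / 2.
  by near: y; exact: near_rV_dist.
have dd : d' < d / 2 by near: d'; exact: nbhs_right_lt.
have xz : `|x - z| < d.
  rewrite -[x](subrK y) -addrA (le_lt_trans (ler_normD _ _))//.
  by rewrite [d]splitr ltrD// (lt_trans yz).
rewrite -[g y](subrK (g x)) -addrA (le_lt_trans (ler_normD _ _))// [e]splitr.
rewrite ltrD//; last by apply: dg; rewrite -ball_normE.
rewrite distrC; apply: dg; rewrite -ball_normE /=.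
by rewrite (lt_trans xy)// ltr_pdivrMr// ltr_pMr// ltr1n.
Unshelve. all: by end_near. Qed.

Lemma PG_comp n m (g : 'rV[R]_m -> R) (f : 'I_m -> 'rV[R]_n -> R) :
  PG g -> (forall i, PG (f i)) -> PG (g \o fun_prod f).
Proof.
move=> [cg [N [M [N0 M0 gM]]]] pf; split.
  move=> x; apply: continuous_comp; last exact: cg.
  by apply: fun_prod_continuous => i; have [] := pf i.
have /choice[K HK] : forall i, exists NM : nat * R, 0 <= NM.2 /\
    forall x, `|f i x| <= NM.2 * (1 + \sum_(i < n) `|x ord0 i|) ^+ NM.1.
  by move=> i; have [_ [N' [M' [_ ? ?]]]] := pf i; exists (N', M').
pose L := (\sum_(i < m) (K i).1).+1.
pose C := 1 + \sum_(i < m) (K i).2.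
have C0 : 0 <= C by apply: addr_ge0 => //; apply: sumr_ge0 => i _; case: (HK i).
exists (L * N)%N, (M * C ^+ N); split.
- by rewrite muln_gt0.
- by rewrite mulr_ge0 ?exprn_ge0.
move=> x; set s := 1 + _.
have s1 : 1 <= s by rewrite lerDl; apply: sumr_ge0.
have s0 : 0 <= s by exact: le_trans s1.
apply: le_trans (gM _) _; rewrite -mulrA; apply: ler_wpM2l => //.
rewrite exprM -exprMn; apply: lerXn2r; rewrite ?nnegrE.
- by apply: addr_ge0 => //; apply: sumr_ge0.
- by rewrite mulr_ge0 ?exprn_ge0.
rewrite mulrDl mul1r lerD ?exprn_ege1// mulr_suml; apply: ler_sum => i _.
have [K0 /(_ x) Kx] := HK i; rewrite mxE; apply: le_trans Kx _.
apply: ler_wpM2l => //; rewrite -/s; apply: ler_weXn2l => //.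
by rewrite /L (bigD1 i)//= -addSn (leq_trans (leqnSn _))// leq_addr.
Qed.

Lemma PGh_comp_set n m (g : 'rV[R]_m -> R) (f : 'I_m -> 'rV[R]_n -> R) :
  PGh_set g -> (forall i, PGh_set (f i)) -> PGh_set (g \o fun_prod f).
Proof.
move=> /PGh_setP[pg [gh Hg]] pf; apply/PGh_setP; split.
  by apply: PG_comp => // i; have [] := pf i.
have /choice[fh Hf] : forall i, exists fh : 'rV[R]_n -> R,
    forall r e : R, 0 < e -> \forall t \near 0^'+, forall x, `|x| <= r ->
      `|fh x - ray_quotient (f i) t x| < e.
  by move=> i; have /PGh_setP[_] := pf i.
have cfh : continuous (fun_prod fh).
  apply: fun_prod_continuous => i; apply: ray_limit_continuous (Hf i).
  by have [[]] := pf i.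
have cgh : continuous gh by apply: ray_limit_continuous Hg; case: pg.
exists (gh \o fun_prod fh) => r e e0.
have [C HC] : exists C, forall x, `|x| <= r -> `|fun_prod fh x| <= C.
  have : compact (fun_prod fh @` [set x | `|x| <= r]).
    apply: continuous_compact (@compact_rV_ball n r).
    exact: continuous_subspaceT.
  move=> /compact_bounded /bounded_set_normP[C HC]; exists C => x xr.
  by apply: HC; exists x.
have e2 : 0 < e / 2 by rewrite divr_gt0.
have [d [d0 d1 Hd]] : exists d, [/\ 0 < d, d < 1 & forall y, `|y| <= C ->
    forall z, `|y - z| < d -> `|gh y - gh z| < e / 2].
  near (0 : R)^'+ => d; exists d; split => //.
    by near: d; exact: uniformly_continuous_rV_ball.
near=> t => x xr.
have t0 : 0 < t by [].
pose y : 'rV[R]_m := \row_i ray_quotient (f i) t x.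
have Fy : `|fun_prod fh x - y| < d.
  have H : forall i, forall x, `|x| <= r ->
      `|fh i x - ray_quotient (f i) t x| < d.
    by near: t; apply: filter_forall => i; exact: Hf.
  by apply: rV_norm_lt => // i; rewrite !mxE; exact: H.
have yC : `|y| <= C + 1.
  rewrite -[y](subrK (fun_prod fh x)) (le_trans (ler_normD _ _))// addrC.
  by rewrite lerD ?HC// distrC ltW// (lt_trans Fy).
have -> : ray_quotient (g \o fun_prod f) t x = ray_quotient g t y.
  rewrite /ray_quotient /=; congr (g _ / t); apply/rowP => i.
  by rewrite !mxE /ray_quotient mulrC divfK// gt_eqF.
have h1 : `|gh y - ray_quotient g t y| < e / 2.
  have H : forall z, `|z| <= C + 1 -> `|gh z - ray_quotient g t z| < e / 2.
    by near: t; exact: Hg.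
  exact: H.
rewrite /= -[gh (fun_prod fh x)](subrK (gh y)) -addrA.
rewrite (le_lt_trans (ler_normD _ _))// [e]splitr ltrD//.
by apply: Hd => //; exact: HC.
Unshelve. all: by end_near. Qed.

Definition row2 (a b : R) : 'rV[R]_2 := \row_i (if i == ord0 then a else b).

Lemma PGh_comp2 n (h : R -> R -> R) (f g : 'rV[R]_n -> R) :
  PGh_set (fun x : 'rV[R]_2 => h (x ord0 ord0) (x ord0 ord_max)) ->
  PGh_set f -> PGh_set g -> PGh_set (fun x => h (f x) (g x)).
Proof.
move=> ph pf pg.
have := @PGh_comp_set n 2 _ (fun i => if i == ord0 then f else g) ph.
rewrite /comp /fun_prod.
under eq_fun do rewrite !mxE /=.
by apply => i; case: ifP.
Qed.

Lemma sum2_ge (x : 'rV[R]_2) :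
  `|x ord0 ord0| + `|x ord0 ord_max| <= 1 * (1 + \sum_(i < 2) `|x ord0 i|).
Proof.
rewrite mul1r big_ord_recr big_ord1 /= (_ : widen_ord _ _ = ord0) ?lerDr//.
exact/val_inj.
Qed.

Lemma PGh_add2 : PGh_set (fun x : 'rV[R]_2 => x ord0 ord0 + x ord0 ord_max).
Proof.
apply: (@homogeneous_PGh _ _ 1).
- by apply: rV_continuousD; exact: coord_continuous.
- by move=> t x t0; rewrite !mxE mulrDr.
- by move=> x; apply: le_trans (sum2_ge x); exact: ler_normD.
Qed.

Lemma PGh_max2 :
  PGh_set (fun x : 'rV[R]_2 => Num.max (x ord0 ord0) (x ord0 ord_max)).
Proof.
apply: (@homogeneous_PGh _ _ 1).
- by apply: rV_continuous_max; exact: coord_continuous.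
- by move=> t x t0; rewrite !mxE maxr_pMr// ltW.
- move=> x; apply: le_trans (sum2_ge x).
  by case: (leP (x ord0 ord0)) => _; rewrite ?lerDl ?lerDr.
Qed.

Lemma PGh_scale1 (a : R) : PGh_set (fun x : 'rV[R]_1 => a * x ord0 ord0).
Proof.
apply: (@homogeneous_PGh _ _ `|a|).
- by apply: rV_continuousM; [exact: cst_continuous|exact: coord_continuous].
- by move=> t x t0; rewrite !mxE mulrCA.
- by move=> x; rewrite normrM big_ord1 ler_wpM2l// lerDr.
Qed.

Lemma PGh_mul2 : PGh_set (fun x : 'rV[R]_2 => x ord0 ord0 * x ord0 ord_max).
Proof.
apply/PGh_setP; split.
  split; first by apply: rV_continuousM; exact: coord_continuous.
  exists 2%N, 1; split=> // x; rewrite normrM.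
  have := sum2_ge x; rewrite !mul1r => H.
  rewrite expr2 ler_pM// (le_trans _ H)// ?lerDl ?lerDr//.
exists (fun=> 0) => r e e0; near=> t => x xr.
have t0 : 0 < t by [].
rewrite /ray_quotient !mxE sub0r normrN.
have -> : t * x ord0 ord0 * (t * x ord0 ord_max) / t =
    t * (x ord0 ord0 * x ord0 ord_max) by field; rewrite gt_eqF.
rewrite !normrM (gtr0_norm t0).
have te : t < e / (1 + `|r| * `|r|).
  by near: t; apply: nbhs_right_lt; rewrite divr_gt0// ltr_pwDl.
have h : `|x ord0 ord0| * `|x ord0 ord_max| <= `|r| * `|r|.
  by apply: ler_pM => //; apply: le_trans (rV_coord_le _ _) _;
    apply: le_trans xr _; exact: ler_norm.
rewrite ltr_pdivlMr ?ltr_pwDl// in te.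
apply: le_lt_trans te; apply: ler_wpM2l; first exact: ltW.
by apply: le_trans h _; rewrite lerDr.
Unshelve. all: by end_near. Qed.

Section Closure.
Variable n : nat.
Implicit Types f g : 'rV[R]_n -> R.

Lemma PGh_setD f g : PGh_set f -> PGh_set g -> PGh_set (fun x => f x + g x).
Proof. exact: PGh_comp2 PGh_add2. Qed.

Lemma PGh_setM f g : PGh_set f -> PGh_set g -> PGh_set (fun x => f x * g x).
Proof. exact: PGh_comp2 PGh_mul2. Qed.

Lemma PGh_set_max f g :
  PGh_set f -> PGh_set g -> PGh_set (fun x => Num.max (f x) (g x)).
Proof. exact: PGh_comp2 PGh_max2. Qed.

Lemma PGh_setZ (a : R) f : PGh_set f -> PGh_set (fun x => a * f x).
Proof.
move=> pf.
have := @PGh_comp_set n 1 _ (fun=> f) (PGh_scale1 a) (fun=> pf).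
by rewrite /comp /fun_prod; under eq_fun do rewrite mxE.
Qed.

Lemma PGh_set_min f g :
  PGh_set f -> PGh_set g -> PGh_set (fun x => Num.min (f x) (g x)).
Proof.
move=> pf pg.
have := PGh_setZ (-1) (PGh_set_max (PGh_setZ (-1) pf) (PGh_setZ (-1) pg)).
by under eq_fun do rewrite !mulN1r oppr_max !opprK.
Qed.

Lemma PGh_set0 : PGh_set (fun _ : 'rV[R]_n => 0 : R).
Proof.
apply: (@homogeneous_PGh _ _ 0).
- exact: cst_continuous.
- by move=> t x t0; rewrite mulr0.
- by move=> x; rewrite normr0 mul0r.
Qed.

End Closure.

Definition PGh_pred n : {pred 'rV[R]_n -> R} := mem (@PGh_set n).

Record PGh n := MkPGh {
  PGh_fun :> 'rV[R]_n -> R;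
  PGh_funP : PGh_fun \in @PGh_pred n
}.

HB.instance Definition _ n := [isSub for @PGh_fun n].
HB.instance Definition _ n := [Choice of PGh n by <:].

Lemma PGh_submod_closed n : submod_closed (@PGh_pred n).
Proof.
split=> [|a f g].
  by rewrite inE; exact: PGh_set0.
by rewrite !inE => pf pg; exact: PGh_setD (PGh_setZ a pf) pg.
Qed.

HB.instance Definition _ n :=
  GRing.isSubmodClosed.Build R ('rV[R]_n -> R) (@PGh_pred n)
    (@PGh_submod_closed n).
HB.instance Definition _ n := [SubChoice_isSubLmodule of PGh n by <:].

Lemma PGhP n (f : PGh n) : PGh_set f.
Proof. by have := PGh_funP f; rewrite inE. Qed.

Lemma PGh_eqP n (f g : PGh n) : f = g <-> f =1 g.
Proof. by split=> [->//|fg]; exact/val_inj/funext. Qed.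

Definition PGh_of n (f : 'rV[R]_n -> R) (pf : PGh_set f) : PGh n :=
  MkPGh (mem_set pf).

Definition PGh_proj n (i : 'I_n) : PGh n := PGh_of (PGh_coord i).

Definition PGh_comp n m (g : PGh m) (f : 'I_m -> PGh n) : PGh n :=
  PGh_of (PGh_comp_set (PGhP g) (fun i => PGhP (f i))).

Definition PGh_le n (f g : PGh n) : bool := `[< forall x, f x <= g x >].

Definition PGh_join n (f g : PGh n) : PGh n :=
  PGh_of (PGh_set_max (PGhP f) (PGhP g)).

Definition PGh_meet n (f g : PGh n) : PGh n :=
  PGh_of (PGh_set_min (PGhP f) (PGhP g)).

Definition PGh_mul n (f g : PGh n) : PGh n :=
  PGh_of (PGh_setM (PGhP f) (PGhP g)).

Lemma PGh_leP n (f g : PGh n) : reflect (forall x, f x <= g x) (PGh_le f g).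
Proof. exact: asboolP. Qed.

Program Definition PGh_lattice_algebra n : lattice_algebra (PGh n) :=
  @LatticeAlgebra R (PGh n) (@PGh_le n) (@PGh_join n) (@PGh_meet n)
    (@PGh_mul n) _ _ _ _ _ _ _ _ _ _ _ _ _.
Next Obligation. by move=> n f; apply/PGh_leP. Qed.
Next Obligation.
move=> n f g /andP[/PGh_leP fg /PGh_leP gf]; apply/PGh_eqP => x.
by apply/eqP; rewrite eq_le fg gf.
Qed.
Next Obligation.
move=> n g f h /PGh_leP fg /PGh_leP gh; apply/PGh_leP => x.
exact: le_trans (fg x) (gh x).
Qed.
Next Obligation.
move=> n f g h /PGh_leP fg; apply/PGh_leP => x.
by rewrite lerD2r; exact: fg.
Qed.
Next Obligation.
move=> n a f g a0 /PGh_leP fg; apply/PGh_leP => x.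
by apply: ler_wpM2l => //; exact: fg.
Qed.
Next Obligation.
move=> n f g h; apply/PGh_leP/andP => [H|[/PGh_leP Hf /PGh_leP Hg] x].
  by split; apply/PGh_leP => x; have := H x; rewrite /= ge_max => /andP[].
by rewrite /= ge_max Hf Hg.
Qed.
Next Obligation.
move=> n f g h; apply/PGh_leP/andP => [H|[/PGh_leP Hf /PGh_leP Hg] x].
  by split; apply/PGh_leP => x; have := H x; rewrite /= le_min => /andP[].
by rewrite /= le_min Hf Hg.
Qed.
Next Obligation. by move=> n f g h; apply/PGh_eqP => x; exact: mulrA. Qed.
Next Obligation. by move=> n f g h; apply/PGh_eqP => x; exact: mulrDl. Qed.
Next Obligation. by move=> n f g h; apply/PGh_eqP => x; exact: mulrDr. Qed.
Next Obligation.
by move=> n a f g; apply/PGh_eqP => x; rewrite /= -mulrA.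
Qed.
Next Obligation.
by move=> n a f g; apply/PGh_eqP => x; exact: mulrCA.
Qed.
Next Obligation.
move=> n f g /PGh_leP f0 /PGh_leP g0; apply/PGh_leP => x.
exact: mulr_ge0 (f0 x) (g0 x).
Qed.

End PolynomialGrowth.

(* Arities start at 1, hence [n.+1]. *)
Definition PG_calculus_without_constants (R : realType) (X : lmodType R)
    (A : lattice_algebra X) :=
  forall (n : nat) (x : 'I_n.+1 -> X),
  exists Psi : {linear PGh R n.+1 -> X},
    lattice_algebra_hom (PGh_lattice_algebra R n.+1) A Psi /\
    forall i, Psi (PGh_proj R i) = x i.

(* Main.v *)
Require Import Defs.
From HB Require Import structures.
From mathcomp Require Import all_boot all_order all_algebra.
From mathcomp Require Import all_classical all_reals all_analysis.

(** The functions max, min and multiplication of two variables belong to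
    $PG_2^h$, so applying the calculus to them gives binary operations on [X];
    the order is the one of the semilattice: $x \le y$ means $x \vee y = y$.
    The composition law implies that every [Psi x] carries the pointwise
    operations of $PG_n^h$ to these operations ([calc_PGh_hom]), and by the
    projection law the entries of [x] lie in the range of [Psi x]; three
    elements are enough below ([common_preimage]).  Hence every identity in at
    most three variables between terms in the vector space, lattice and
    product operations that holds in the real numbers, and so pointwise in
    $PG_3^h$, holds in [X].

    The axioms of a lattice-ordered algebra and of an $f$-algebra are not all
    identities: some are implications.  Those follow from identities in which
    the hypotheses have been absorbed.  For instance a positive element is its
    own positive part, so positivity of products only needs
    $0 \le (x \vee 0)(y \vee 0)$; and if $x \wedge y = 0$ and $z \ge 0$, then
    [x], [y], [z] equal $x - x \wedge y$, $y - x \wedge y$, $z \vee 0$, for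
    which the $f$-algebra condition is an identity
    ([calc_meet_mul_disjoint]).
    The maps [Psi x] themselves then form the required calculus. *)

Set Implicit Arguments.
Unset Strict Implicit.
Unset Printing Implicit Defensive.

Import Order.TTheory GRing.Theory Num.Theory.

Local Open Scope ring_scope.

Definition pair_family (T : Type) (a b : T) : 'I_2 -> T :=
  fun i => if i == ord0 then a else b.

(** Binary operations on the real numbers become elements of $PG_2^h$, which
    the calculus can evaluate, when applied to the two coordinates. *)
Definition max_fun (R : realType) : PGh R 2 :=
  PGh_join (PGh_proj R ord0) (PGh_proj R ord_max).
Definition min_fun (R : realType) : PGh R 2 :=
  PGh_meet (PGh_proj R ord0) (PGh_proj R ord_max).
Definition mul_fun (R : realType) : PGh R 2 :=
  PGh_mul (PGh_proj R ord0) (PGh_proj R ord_max).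

Lemma PGh_comp_max (R : realType) n (f g : PGh R n) :
  PGh_comp (max_fun R) (pair_family f g) = PGh_join f g.
Proof. by apply/PGh_eqP => t; rewrite /= !mxE. Qed.

Lemma PGh_comp_min (R : realType) n (f g : PGh R n) :
  PGh_comp (min_fun R) (pair_family f g) = PGh_meet f g.
Proof. by apply/PGh_eqP => t; rewrite /= !mxE. Qed.

Lemma PGh_comp_mul (R : realType) n (f g : PGh R n) :
  PGh_comp (mul_fun R) (pair_family f g) = PGh_mul f g.
Proof. by apply/PGh_eqP => t; rewrite /= !mxE. Qed.

Section Pointwise.
Variables (R : realType) (n : nat).
Implicit Types (f g : PGh R n) (t : 'rV[R]_n).

Fact PGh_add_apply f g t : (f + g) t = f t + g t. Proof. by []. Qed.
Fact PGh_opp_apply f t : (- f) t = - f t. Proof. by []. Qed.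
Fact PGh_zero_apply t : (0 : PGh R n) t = 0. Proof. by []. Qed.
Fact PGh_scale_apply a f t : (a *: f) t = a * f t. Proof. by []. Qed.

Fact PGh_join_apply f g t : PGh_join f g t = Num.max (f t) (g t).
Proof. by []. Qed.

Fact PGh_meet_apply f g t : PGh_meet f g t = Num.min (f t) (g t).
Proof. by []. Qed.

Fact PGh_mul_apply f g t : PGh_mul f g t = f t * g t. Proof. by []. Qed.

Definition PGh_applyE := (PGh_add_apply, PGh_opp_apply, PGh_zero_apply,
  PGh_scale_apply, PGh_join_apply, PGh_meet_apply, PGh_mul_apply).

End Pointwise.

Section Calculus.
Variables (R : realType) (X : lmodType R).
Variable Psi : forall n : nat, ('I_n.+1 -> X) -> {linear PGh R n.+1 -> X}.
Hypothesis Psi_proj : forall (n : nat) (x : 'I_n.+1 -> X) (i : 'I_n.+1),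
  Psi x (PGh_proj R i) = x i.
Hypothesis Psi_comp : forall (m n : nat) (x : 'I_n.+1 -> X)
    (f : 'I_m.+1 -> PGh R n.+1) (g : PGh R m.+1),
  Psi (fun i => Psi x (f i)) g = Psi x (PGh_comp g f).

Definition calc_op (op : PGh R 2) (x y : X) : X := Psi (pair_family x y) op.

(** This is the composition law for two inner functions. *)
Lemma Psi_calc_op n (x : 'I_n.+1 -> X) (op : PGh R 2) (f g : PGh R n.+1) :
  Psi x (PGh_comp op (pair_family f g)) = calc_op op (Psi x f) (Psi x g).
Proof.
rewrite -Psi_comp /calc_op; congr (Psi _ op).
by apply/funext => i; rewrite /pair_family; case: ifP.
Qed.

Notation join := (calc_op (max_fun R)).
Notation meet := (calc_op (min_fun R)).
Notation mul := (calc_op (mul_fun R)).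

Lemma calc_PGh_hom n (x : 'I_n.+1 -> X) :
  [/\ {morph Psi x : f g / PGh_join f g >-> join f g},
      {morph Psi x : f g / PGh_meet f g >-> meet f g} &
      {morph Psi x : f g / PGh_mul f g >-> mul f g}].
Proof.
split=> f g; rewrite -Psi_calc_op.
- by rewrite PGh_comp_max.
- by rewrite PGh_comp_min.
- by rewrite PGh_comp_mul.
Qed.

(** Transfer principle: an identity in three variables can be checked on the
    range of a homomorphism defined on an algebra of real functions. *)
Lemma common_preimage (x y z : X) :
  exists P : {linear PGh R 3 -> X},
    [/\ {morph P : f g / PGh_join f g >-> join f g},
        {morph P : f g / PGh_meet f g >-> meet f g} &
        {morph P : f g / PGh_mul f g >-> mul f g}] /\
    exists f g h, [/\ P f = x, P g = y & P h = z].
Proof.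
pose u (i : 'I_3) := nth 0 [:: x; y; z] i.
exists (Psi u); split; first exact: calc_PGh_hom.
exists (PGh_proj R (inord 0)), (PGh_proj R (inord 1)), (PGh_proj R (inord 2)).
by split; rewrite Psi_proj /u inordK.
Qed.

(* Replaces three elements of [X] by the images of three functions and
   reduces an equation in [X] to a pointwise one between real numbers. *)
Local Ltac transfer x y z :=
  let P := fresh "P" in let jP := fresh in let mP := fresh in
  let pP := fresh in let t := fresh "t" in
  have [P [[jP mP pP] [? [? [? [<- <- <-]]]]]] := common_preimage x y z;
  rewrite -?(linear0 P);
  rewrite -?(jP, mP, pP, linearD P, linearB P, linearZ_LR P);
  congr (P _); apply/PGh_eqP => t; rewrite !PGh_applyE.

Lemma calc_joinxx x : join x x = x.
Proof. by transfer x x x; exact: maxxx. Qed.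

Lemma calc_joinC x y : join x y = join y x.
Proof. by transfer x y y; exact: maxC. Qed.

Lemma calc_joinA x y z : join x (join y z) = join (join x y) z.
Proof. by transfer x y z; exact: maxA. Qed.

Lemma calc_meetC x y : meet x y = meet y x.
Proof. by transfer x y y; exact: minC. Qed.

Lemma calc_join_meetK x y : join (meet x y) x = x.
Proof. by transfer x y y; rewrite minC minxK. Qed.

Lemma calc_join_meetr z x y : join z (meet x y) = meet (join z x) (join z y).
Proof. by transfer x y z; exact: max_minr. Qed.

Lemma calc_joinD x y z : join (x + z) (y + z) = join x y + z.
Proof. by transfer x y z; rewrite addr_maxl. Qed.

Lemma calc_joinZ (a : R) x y :
  0 <= a -> join (a *: x) (a *: y) = a *: join x y.
Proof. by move=> a0; transfer x y y; rewrite maxr_pMr. Qed.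

Lemma calc_mulA x y z : mul x (mul y z) = mul (mul x y) z.
Proof. by transfer x y z; exact: mulrA. Qed.

Lemma calc_mulC x y : mul x y = mul y x.
Proof. by transfer x y y; exact: mulrC. Qed.

Lemma calc_mulDl x y z : mul (x + y) z = mul x z + mul y z.
Proof. by transfer x y z; exact: mulrDl. Qed.

Lemma calc_mulZl (a : R) x y : mul (a *: x) y = a *: mul x y.
Proof. by transfer x y y; rewrite mulrA. Qed.

(** Positivity of products, with the hypotheses $0 \le x$ and $0 \le y$
    absorbed by passing to positive parts. *)
Lemma calc_mul_pos_part x y :
  join 0 (mul (join 0 x) (join 0 y)) = mul (join 0 x) (join 0 y).
Proof. by transfer x y y; apply/max_r; rewrite mulr_ge0 // le_max lexx. Qed.

(** The $f$-algebra condition with its hypotheses absorbed.  Pointwise, one of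
    the two differences vanishes and the other is nonnegative. *)
Lemma calc_meet_mul_disjoint x y z :
  meet (mul (join 0 z) (x - meet x y)) (y - meet x y) = 0.
Proof.
have H (a b c : R) :
    Num.min (Num.max 0 c * (a - Num.min a b)) (b - Num.min a b) = 0.
  have [ab|/ltW ba] := leP a b.
    by rewrite subrr mulr0 min_l // subr_ge0.
  by rewrite subrr min_r // mulr_ge0 ?le_max ?lexx // subr_ge0.
by transfer x y z; exact: H.
Qed.

(** The order is the only one for which [join] can be the supremum. *)
Definition calc_le (x y : X) : bool := join x y == y.

Program Definition calc_lattice_algebra : lattice_algebra X :=
  @LatticeAlgebra R X calc_le join meet mul _ _ _ _ _ _ _ calc_mulA calc_mulDl
    _ calc_mulZl _ _.
Next Obligation. by move=> x; rewrite /calc_le calc_joinxx. Qed.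
Next Obligation.
by move=> x y /andP[/eqP xy /eqP yx]; rewrite -xy calc_joinC yx.
Qed.
Next Obligation.
move=> y x z /eqP xy /eqP yz; rewrite /calc_le -{1}yz calc_joinA xy.
by rewrite yz.
Qed.
Next Obligation. by move=> x y z /eqP xy; rewrite /calc_le calc_joinD xy. Qed.
Next Obligation.
by move=> a x y a0 /eqP xy; rewrite /calc_le calc_joinZ // xy.
Qed.
Next Obligation.
move=> x y z; apply/eqP/andP => [xyz|[/eqP xz /eqP yz]]; last first.
  by rewrite -calc_joinA yz xz.
split; apply/eqP; rewrite -[in LHS]xyz -[RHS]xyz.
  by rewrite !calc_joinA calc_joinxx.
by rewrite (calc_joinC x y) !calc_joinA calc_joinxx.
Qed.
Next Obligation.
move=> x y z; apply/eqP/andP => [zxy|[/eqP zx /eqP zy]]; last first.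
  by rewrite calc_join_meetr zx zy.
split; apply/eqP.
  by rewrite -(calc_join_meetK x y) calc_joinA zxy.
by rewrite -(calc_join_meetK y x) calc_joinA (calc_meetC y x) zxy.
Qed.
Next Obligation.
by move=> x y z; rewrite calc_mulC calc_mulDl !(calc_mulC x).
Qed.
Next Obligation.
by move=> a x y; rewrite calc_mulC calc_mulZl (calc_mulC x).
Qed.
Next Obligation.
move=> x y /eqP x0 /eqP y0; rewrite /calc_le -x0 -y0.
by rewrite calc_mul_pos_part.
Qed.

Lemma calc_f_algebra : f_algebra calc_lattice_algebra.
Proof.
move=> x y z /= xy /eqP z0.
have zxy : meet (mul z x) y = 0.
  by have := calc_meet_mul_disjoint x y z; rewrite xy z0 !subr0.
by split=> //; rewrite calc_mulC.
Qed.

Lemma calc_calculus : PG_calculus_without_constants calc_lattice_algebra.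
Proof. by move=> n x; exists (Psi x); split; first exact: calc_PGh_hom. Qed.

End Calculus.

Theorem theorem4p1 (R : realType) (X : lmodType R)
    (Psi : forall n : nat, ('I_n.+1 -> X) -> {linear PGh R n.+1 -> X})
    (Psi_proj : forall (n : nat) (x : 'I_n.+1 -> X) (i : 'I_n.+1),
      Psi n x (PGh_proj R i) = x i)
    (Psi_comp : forall (m n : nat) (x : 'I_n.+1 -> X)
      (f : 'I_m.+1 -> PGh R n.+1) (g : PGh R m.+1),
      Psi m (fun i => Psi n x (f i)) g = Psi n x (PGh_comp g f)) :
  exists A : lattice_algebra X,
    [/\ f_algebra A, commutative (la_mul A) & PG_calculus_without_constants A].
Proof.
exists (calc_lattice_algebra Psi_proj Psi_comp); split.
- exact: calc_f_algebra.
- exact: calc_mulC Psi_proj Psi_comp.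
- exact: calc_calculus.
Qed.
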